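(* For $n\ge 1$ let $T_n$ be the number of complete non-ambiguous trees (CNATs) of size $n$, and for $\epsilon\in\{+1,-1\}$ let $T(n;\epsilon)$ be the number of CNATs $T$ of size $n$ with $\det M(T)=\epsilon$. If $n>1$ is odd, then $$T(n;+1)=T(n;-1)=\frac{T_n}{2}.$$ If $n=2p$ is even, then $$T(2p;+1)=\frac{T_{2p}+(-1)^pT_p}{2}\quad\text{and}\quad T(2p;-1)=\frac{T_{2p}-(-1)^pT_p}{2}.$$
   Context: A non-ambiguous tree (NAT) is a filling of an $m\times n$ rectangular grid in which each cell is dotted or not, such that: the top-left cell is dotted (the root); every dotted cell other than the root has either a dotted cell above it in the same column or a dotted cell to its left in the same row, but not both; and every row and every column contains at least one dotted cell. Each non-root dot $d$ has a parent: the nearest dot above it in its column, or the nearest dot to its left in its row (exactly one of these two kinds of dots exists). A complete non-ambiguous tree (CNAT) is a NAT in which every dot either has both a dot below it in its column and a dot to its right in its row (an internal dot), or neither (a leaf). The size of a CNAT is its number of leaves. Rows are labelled $1,2,\dots$ from top to bottom and columns from left to right. $M(T)$ is the $0/1$ matrix with entry $1$ exactly at the dotted cells of $T$; for a CNAT this matrix is square, since each row and each column contains exactly one leaf. *)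

(* Defs.v *)
From HB Require Import structures.
From mathcomp Require Import all_boot all_order all_algebra.
Set Implicit Arguments.
Unset Strict Implicit.
Unset Printing Implicit Defensive.
Import Order.TTheory GRing.Theory Num.Theory.
Local Open Scope ring_scope.

(* A filling of an m x k grid is a boolean matrix. Indices start at 0, rows
   going from top to bottom and columns from left to right. *)
Section Fillings.
Variables m k : nat.
Implicit Types (T : 'M[bool]_(m, k)) (i : 'I_m) (j : 'I_k).

Definition dot_above T i j : bool := [exists i' : 'I_m, (i' < i)%N && T i' j].
Definition dot_left T i j : bool := [exists j' : 'I_k, (j' < j)%N && T i j'].
Definition dot_below T i j : bool := [exists i' : 'I_m, (i < i')%N && T i' j].
Definition dot_right T i j : bool := [exists j' : 'I_k, (j < j')%N && T i j'].

Definition root_cell i j : bool := (i == 0%N :> nat) && (j == 0%N :> nat).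

Definition is_nat T : bool :=
  [&& [exists i, exists j, root_cell i j && T i j],
      [forall i, forall j,
         T i j && ~~ root_cell i j ==> (dot_above T i j (+) dot_left T i j)],
      [forall i, exists j, T i j]
    & [forall j, exists i, T i j]].

Definition is_internal T i j : bool :=
  [&& T i j, dot_below T i j & dot_right T i j].
Definition is_leaf T i j : bool :=
  [&& T i j, ~~ dot_below T i j & ~~ dot_right T i j].

Definition is_cnat T : bool :=
  is_nat T &&
  [forall i, forall j, T i j ==> is_internal T i j || is_leaf T i j].

Definition cnat_size T : nat :=
  #|[set c : 'I_m * 'I_k | is_leaf T c.1 c.2]|.

Definition nat_matrix T : 'M[int]_(m, k) := map_mx (fun b : bool => b%:R) T.

End Fillings.

Lemma cnat_row_leaf m k (T : 'M[bool]_(m, k)) (i : 'I_m) :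
  is_cnat T -> exists! j, is_leaf T i j.
Proof.
case/andP=> /and4P[_ _ /forallP/(_ i)/existsP[j0 Tj0] _] /forallP/(_ i)/forallP Hc.
case: (@arg_maxnP _ j0 (fun j => T i j) (fun j => j : nat) Tj0) => j Tj jmax0.
have jmax j' : T i j' -> (j' <= j)%N by exact: jmax0.
exists j; split=> [|j' /and3P[Tj' _ /existsPn Hr]].
  have /implyP/(_ Tj)/orP[/and3P[_ _ /existsP[j' /andP[jj' Tj']]]|//] := Hc j.
  by have := jmax j' Tj'; rewrite /= leqNgt jj'.
apply/val_inj/eqP; rewrite eqn_leq /= (jmax _ Tj') andbT.
by have := Hr j; rewrite Tj andbT -leqNgt.
Qed.

Section Transpose.
Variables (m k : nat) (T : 'M[bool]_(m, k)).

Lemma dot_above_tr i j : dot_above T^T j i = dot_left T i j.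
Proof. by apply: eq_existsb => j'; rewrite mxE. Qed.

Lemma dot_left_tr i j : dot_left T^T j i = dot_above T i j.
Proof. by apply: eq_existsb => i'; rewrite mxE. Qed.

Lemma dot_below_tr i j : dot_below T^T j i = dot_right T i j.
Proof. by apply: eq_existsb => j'; rewrite mxE. Qed.

Lemma dot_right_tr i j : dot_right T^T j i = dot_below T i j.
Proof. by apply: eq_existsb => i'; rewrite mxE. Qed.

Lemma is_internal_tr i j : is_internal T^T j i = is_internal T i j.
Proof.
by rewrite /is_internal mxE dot_below_tr dot_right_tr;
congr andb; rewrite andbC.
Qed.

Lemma is_leaf_tr i j : is_leaf T^T j i = is_leaf T i j.
Proof.
by rewrite /is_leaf mxE dot_below_tr dot_right_tr;
congr andb; rewrite andbC.
Qed.

Lemma is_cnat_tr : is_cnat T -> is_cnat T^T.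
Proof.
case/andP=> /and4P[/existsP[i0 /existsP[j0 /andP[Hr Tij]]] H1 H2 H3] H4.
apply/andP; split; last first.
  apply/forallP=> j; apply/forallP=> i.
  by rewrite mxE is_internal_tr is_leaf_tr; have /forallP/(_ j) := forallP H4 i.
apply/and4P; split.
- apply/existsP; exists j0; apply/existsP; exists i0.
  by rewrite mxE Tij andbT /root_cell andbC.
- apply/forallP=> j; apply/forallP=> i.
  rewrite mxE dot_above_tr dot_left_tr addbC.
  by have /forallP/(_ j) := forallP H1 i; rewrite /root_cell [X in ~~ X]andbC.
- apply/forallP=> j; have /existsP[i Hi] := forallP H3 j.
  by apply/existsP; exists i; rewrite mxE.
- apply/forallP=> i; have /existsP[j Hj] := forallP H2 i.
  by apply/existsP; exists j; rewrite mxE.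
Qed.

Lemma cnat_size_tr : cnat_size T^T = cnat_size T.
Proof.
pose sw (c : 'I_k * 'I_m) := (c.2, c.1).
have sw_inj : injective sw by move=> [a b] [c d] [-> ->].
rewrite /cnat_size -(card_imset _ sw_inj); apply: eq_card => -[i j].
rewrite inE /=; apply/imsetP/idP => [[[j' i']]|H].
  by rewrite inE /= is_leaf_tr => H [-> ->].
by exists (j, i); rewrite ?inE //= is_leaf_tr.
Qed.

End Transpose.

Lemma cnat_size_rows m k (T : 'M[bool]_(m, k)) : is_cnat T -> cnat_size T = m.
Proof.
move=> HT; apply: etrans (card_ord m); rewrite /cnat_size.
have injf : {in [set c : 'I_m * 'I_k | is_leaf T c.1 c.2] &, injective fst}.
  move=> [i j] [i' j'] /[!inE] /= H H' e; subst i'.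
  by have [j0 [_ U]] := cnat_row_leaf i HT; rewrite -(U _ H) -(U _ H').
rewrite -(card_in_imset injf) -cardsT; congr #|pred_of_set _|.
apply/setP=> i; rewrite inE; apply/imsetP.
by have [j [Hj _]] := cnat_row_leaf i HT; exists (i, j); rewrite ?inE.
Qed.

(* A CNAT of size n fills an n x n grid, so that counting square fillings in
   [cnat_set] below misses no CNAT of size n. *)
Lemma cnat_square m k (T : 'M[bool]_(m, k)) :
  is_cnat T -> m = cnat_size T /\ k = cnat_size T.
Proof.
move=> HT; split; first by rewrite cnat_size_rows.
by rewrite -cnat_size_tr (cnat_size_rows (is_cnat_tr HT)).
Qed.

Definition cnat_set (n : nat) : {set 'M[bool]_n} :=
  [set T : 'M[bool]_n | is_cnat T & cnat_size T == n].

Definition num_cnat (n : nat) : nat := #|cnat_set n|.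

Definition num_cnat_det (n : nat) (eps : int) : nat :=
  #|[set T in cnat_set n | \det (nat_matrix T) == eps]|.

(* Main.v *)
Require Import Defs.
From HB Require Import structures.
From mathcomp Require Import all_boot all_order all_algebra.
From mathcomp Require Import fingroup perm zify ring.
Set Implicit Arguments.
Unset Strict Implicit.
Unset Printing Implicit Defensive.
Import Order.TTheory GRing.Theory Num.Theory.
Local Open Scope ring_scope.

(* The only permutation supported by the dots of a CNAT is the one formed by
   its leaves, so det M(T) is its sign and the theorem amounts to computing the
   sum S_n of det M(T) over all CNATs of size n.  Exchanging two adjacent rows
   other than the root row gives again a CNAT, with opposite determinant,
   provided that no column has a dot in both rows.  Group the rows and the
   columns into pairs of adjacent ones (leaving out row and column 0 when n is
   odd): in S_n there remain only the CNATs in which any two paired rows share a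
   column and any two paired columns share a row.  Looking at the end of each
   row and column, one sees that for odd n > 1 there is no such CNAT, and that
   for n = 2p they are obtained from the CNATs of size p by substituting
   [1 0; 0 0] for each internal dot and [1 1; 1 0] for each leaf, which gives a
   determinant (-1)^p.  Hence S_n = 0 for odd n > 1 and S_2p = (-1)^p T_p. *)

(* CNATs are handled as relations on nat that are false outside the grid, so
   that indices can be doubled and halved freely. *)
Record cnat_fun (n : nat) (t : nat -> nat -> bool) : Prop := CnatFun {
  cnat_bound : forall a b, t a b -> (a < n)%N /\ (b < n)%N;
  cnat_root : t 0%N 0%N;
  cnat_row : forall a, (a < n)%N -> exists b, t a b;
  cnat_col : forall b, (b < n)%N -> exists a, t a b;
  cnat_parent : forall a b, t a b -> (0 < a + b)%N ->
    (exists2 a', (a' < a)%N & t a' b) \/ (exists2 b', (b' < b)%N & t a b');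
  cnat_parent1 : forall a b a' b', t a b ->
    (a' < a)%N -> t a' b -> (b' < b)%N -> t a b' -> False;
  cnat_below : forall a b a', t a b -> (a < a')%N -> t a' b ->
    exists2 b', (b < b')%N & t a b';
  cnat_right : forall a b b', t a b -> (b < b')%N -> t a b' ->
    exists2 a', (a < a')%N & t a' b
}.

Lemma cnat_fun_tr n t : cnat_fun n t -> cnat_fun n (fun a b => t b a).
Proof.
case=> tB t0 tR tC tP tP1 tb tr; split=> //.
- by move=> a b /tB[].
- move=> a b tba; rewrite addnC => ba0.
  by case: (tP _ _ tba ba0) => ?; [right | left].
- by move=> a b a' b' tba a'a ta'b b'b tab'; apply: (tP1 b a b' a').
- by move=> a b a'; apply: tr.
- by move=> a b b'; apply: tb.
Qed.

(** * Last dots of rows and columns *)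

Section CnatFun.
Variables (n : nat) (t : nat -> nat -> bool).
Hypothesis ct : cnat_fun n t.

Lemma row_end a b : t a b ->
  exists l, [/\ (b <= l)%N, t a l & forall l', t a l' -> (l' <= l)%N].
Proof.
move=> tab; have exP : exists b, t a b by exists b.
have ub l : t a l -> (l <= n)%N by case/(cnat_bound ct)=> _ /ltnW.
by case: (ex_maxnP exP ub) => l tal lmax; exists l; split=> //; apply: lmax.
Qed.

(** A dot with one above it has none to its left; with none below it, completeness leaves none to
    its right either. *)
Lemma col_end_single a b a' : t a b -> (a' < a)%N -> t a' b ->
  (forall a'', t a'' b -> (a'' <= a)%N) -> forall b', t a b' -> b' = b.
Proof.
move=> tab a'a ta'b amax b' tab'; case: (ltngtP b' b) => // [b'b|bb'].
  by case: (cnat_parent1 ct tab a'a ta'b b'b tab').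
by have [a'' aa''] := cnat_right ct tab bb' tab' => /amax; rewrite leqNgt aa''.
Qed.

End CnatFun.

(* The pairs are (0, 1), (2, 3), ... for even n and (1, 2), (3, 4), ... for
   odd n. *)
Definition paired n (t : nat -> nat -> bool) := forall a,
  ~~ odd (a + n) -> (a.+1 < n)%N -> exists b, t a b && t a.+1 b.

(** * CNATs in which all paired rows and all paired columns meet *)

Section Pairing.
Variable n : nat.
Implicit Type t : nat -> nat -> bool.

Lemma row_end_single t a b b' : cnat_fun n t -> t a b -> (b' < b)%N -> t a b' ->
  (forall l, t a l -> (l <= b)%N) -> forall a', t a' b -> a' = a.
Proof.
by move=> /cnat_fun_tr ct tab b'b tab' bmax; apply: (col_end_single ct tab b'b).
Qed.

Lemma col_end t a b : cnat_fun n t -> t a b ->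
  exists l, [/\ (a <= l)%N, t l b & forall l', t l' b -> (l' <= l)%N].
Proof. by move=> /cnat_fun_tr /row_end; apply. Qed.

(** The dot ending the row is alone in its column, so [a] is the only row that column [l] can share
    with its partner. The partner is not [l.+1], which lies past the end, so it is [l.-1]. *)
Lemma row_end_pair t a l b : cnat_fun n t -> paired n (fun a b => t b a) ->
  t a l -> (b < l)%N -> t a b -> (forall l', t a l' -> (l' <= l)%N) ->
  odd (l + n) /\ t a l.-1.
Proof.
move=> ct pt tal bl tab lmax; have sg := row_end_single ct tal bl tab lmax.
have [_ ln] := cnat_bound ct tal.
have [lo|le] := boolP (odd (l + n)); last first.
  have [|a' /andP[/sg -> /lmax]] := pt l le; lia.
split=> //; have [||a' /andP[]] := pt l.-1; try lia.
by move=> ta'; rewrite (ltn_predK bl) => /sg <-.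
Qed.

(* Otherwise the column of (i, l - 1) would end below row [i + 1]; the row
   above that end would be a larger counterexample. *)
Lemma leaf_block t i l j : cnat_fun n t -> paired n t ->
  paired n (fun a b => t b a) -> t i l -> (j < l)%N -> t i j ->
  (forall l', t i l' -> (l' <= l)%N) ->
  [/\ odd (l + n), ~~ odd (i + n), t i l.-1 & t i.+1 l.-1] /\
  (forall b, t i.+1 b -> b = l.-1).
Proof.
move=> ct pt pt'; have [k] := ubnP (n - i).
elim: k => // k IH in i l j *; rewrite ltnS => nik til jl tij lmax.
have [lo til1] := row_end_pair ct pt' til jl tij lmax.
have [|r ir tr] := cnat_right ct til1 _ til; first by lia.
have [q [rq tq qmax]] := col_end ct tr.
have iq : (i < q)%N by lia.
have [qo tq1] := row_end_pair (cnat_fun_tr ct) pt tq iq til1 qmax.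
have qs := col_end_single ct tq iq til1 qmax.
have [qi|qi] := eqVneq q.-1 i.
  have eq : q = i.+1 by lia.
  by subst q; split; [split=> //; lia | ].
have [|l2 l2l tl2] := cnat_below ct tq1 _ tq; first by lia.
have [e [l2e te emax]] := row_end ct tl2.
have l1e : (l.-1 < e)%N by lia.
(* The block at the end of row [q.-1] puts a dot at [(q, e.-1)]. Row [q] has its only dot in column
   [l.-1], so [e = l]; but [(i, l)] is alone in column [l]. *)
have [|[_ _ _]] := IH _ _ _ _ te l1e tq1 emax.
  by have [] := cnat_bound ct til; lia.
have -> : q.-1.+1 = q by lia.
move=> /qs ee _; have el : e = l by lia.
by case/eqP: qi; apply: (row_end_single ct til jl tij lmax); rewrite -el.
Qed.

End Pairing.

(** Row 0 has no partner, so by [leaf_block] it contains only the root. If [n > 1], the leftmost dot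
    of row 1 must then lie under the root, and completeness gives row 0 a second dot. *)
Lemma paired_odd_size n t : cnat_fun n t -> paired n t ->
  paired n (fun a b => t b a) -> odd n -> n = 1%N.
Proof.
move=> ct pt pt' no; have [//|n1] := eqVneq n 1%N.
have [|b t1b] := cnat_row ct (a := 1); first by lia.
have [e [ce te emax]] := row_end ct (cnat_root ct).
have [e0|e0] := posnP e; last first.
  have [[_ h _ _] _] := leaf_block ct pt pt' te e0 (cnat_root ct) emax.
  by rewrite no in h.
have sg d : t 1%N d -> d != 0%N -> exists2 d', (d' < d)%N & t 1%N d'.
  move=> t1d d0; have [|[a' a1 ta]|//] := cnat_parent ct t1d; first by lia.
  have a0 : a' = 0%N by lia.
  by subst a'; have := emax _ ta; lia.
have t10 : t 1%N 0%N.
  have exP : exists b, t 1%N b by exists b.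
  case: (ex_minnP exP) => d t1d dmin; have [d0 | d0] := eqVneq d 0%N.
    by rewrite d0 in t1d.
  by have [d' d'd /dmin] := sg d t1d d0; rewrite leqNgt d'd.
have [d] := cnat_below ct (cnat_root ct) (ltn0Sn 0) t10.
by move=> d0 /emax; lia.
Qed.

(** * Dilation: from size p to a paired CNAT of size 2p *)

Definition leaf_at n (t : nat -> nat -> bool) a b :=
  t a b && all (fun c => ((c <= a) || ~~ t c b) && ((c <= b) || ~~ t a c))%N
             (iota 0 n).

(* Each internal dot becomes the block [1 0; 0 0] and each leaf the block
   [1 1; 1 0]. *)
Definition dilate p (t : nat -> nat -> bool) a b :=
  if odd a then ~~ odd b && leaf_at p t a./2 b./2
  else if odd b then leaf_at p t a./2 b./2 else t a./2 b./2.

Section Dilate.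
Variable p : nat.
Implicit Type t : nat -> nat -> bool.

Lemma leaf_atP t a b : cnat_fun p t ->
  reflect [/\ t a b, forall a', t a' b -> (a' <= a)%N
            & forall b', t a b' -> (b' <= b)%N] (leaf_at p t a b).
Proof.
move=> ct; apply: (iffP andP) => [[tab /allP al]|[tab amax bmax]].
  split=> // c tc; have [? ?] := cnat_bound ct tc.
    by have := al c; rewrite mem_iota tc /= orbF add0n => /(_ _)/andP[].
  by have := al c; rewrite mem_iota tc /= orbF add0n => /(_ _)/andP[].
split=> //; apply/allP=> c _; apply/andP; split.
  by case: leqP => //= ac; apply/negP=> /amax; rewrite leqNgt ac.
by case: leqP => //= ac; apply/negP=> /bmax; rewrite leqNgt ac.
Qed.

Lemma leaf_at_tr t a b : leaf_at p (fun a b => t b a) a b = leaf_at p t b a.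
Proof. by congr andb; apply: eq_all => c; rewrite andbC. Qed.

Lemma dilate_tr t a b : dilate p (fun a b => t b a) a b = dilate p t b a.
Proof.
by rewrite /dilate leaf_at_tr; case: (odd a); case: (odd b).
Qed.

Lemma row_leaf t a : cnat_fun p t -> (a < p)%N -> exists b, leaf_at p t a b.
Proof.
move=> ct /(cnat_row ct)[b /(row_end ct)[l [_ tal lmax]]].
exists l; apply/(leaf_atP _ _ ct); split=> // a' ta'.
case: leqP => // aa'; have [b' lb' /lmax] := cnat_below ct tal aa' ta'.
by rewrite leqNgt lb'.
Qed.

Lemma dilate_base t a b : dilate p t a b -> t a./2 b./2.
Proof.
by rewrite /dilate; case: (odd a); case: (odd b) => //= /andP[].
Qed.

Lemma dilate_even t a b : dilate p t a.*2 b.*2 = t a b.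
Proof. by rewrite /dilate !odd_double !doubleK. Qed.

Lemma dilate_odd_row t a b : dilate p t a.*2.+1 b.*2 = leaf_at p t a b.
Proof. by rewrite /dilate /= !odd_double !doubleK /= uphalf_double. Qed.

Lemma dilate_odd_col t a b : dilate p t a.*2 b.*2.+1 = leaf_at p t a b.
Proof. by rewrite /dilate /= !odd_double !doubleK /= uphalf_double. Qed.

Lemma dilate_odd t a b : dilate p t a.*2.+1 b.*2.+1 = false.
Proof. by rewrite /dilate /= !odd_double. Qed.

Lemma dilate_leaf t a b : dilate p t a b -> odd a || odd b ->
  odd a (+) odd b /\ leaf_at p t a./2 b./2.
Proof. by rewrite /dilate; case: (odd a); case: (odd b). Qed.

Lemma dilate_row t : cnat_fun p t ->
  forall a, (a < p.*2)%N -> exists b, dilate p t a b.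
Proof.
move=> ct a ap; have [|b lb] := row_leaf (a := a./2) ct; first by lia.
exists b.*2; rewrite /dilate odd_double doubleK /=.
by case: odd => //; case/andP: lb.
Qed.

(** A dot with an odd index comes from a leaf and has nothing below it. For a dot with even indices,
    either the dot below is in the same block, which is then a leaf block and has a dot on the
    right, or the dot on the right is lifted from [t]. *)
Lemma dilate_below t a b a' : cnat_fun p t ->
  dilate p t a b -> (a < a')%N -> dilate p t a' b ->
  exists2 b', (b < b')%N & dilate p t a b'.
Proof.
move=> ct tab aa' ta'b; have t1 := dilate_base tab; have t2 := dilate_base ta'b.
have [/(dilate_leaf tab)[ab /(leaf_atP _ _ ct)[_ amax _]]|] :=
  boolP (odd a || odd b).
  have aa2 : a'./2 = a./2 by have := amax _ t2; lia.
  have [] := dilate_leaf ta'b; first by lia.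
  by lia.
rewrite negb_or => /andP[ae be]; have [aa2|aa2] := eqVneq a'./2 a./2.
  have [|_] := dilate_leaf ta'b; first by lia.
  rewrite aa2 => lf; exists b.+1 => //.
  by rewrite /dilate (negPf ae) /= be uphalf_half (negPf be).
have [|b' bb' tab'] := cnat_below ct t1 _ t2; first by lia.
exists b'.*2; first by lia.
by rewrite /dilate (negPf ae) odd_double doubleK.
Qed.

Lemma dilate_cnat t : cnat_fun p t -> cnat_fun p.*2 (dilate p t).
Proof.
move=> ct; have ct' := cnat_fun_tr ct; split.
- by move=> a b /dilate_base/(cnat_bound ct)[]; lia.
- by rewrite (dilate_even _ 0 0) (cnat_root ct).
- exact: dilate_row.
- by move=> b /(dilate_row ct')[a]; rewrite dilate_tr; exists a.
- move=> a b tab ab0; have t1 := dilate_base tab.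
  have [o|] := boolP (odd a || odd b).
    have [ab lf] := dilate_leaf tab o.
    (* The parent is the top-left corner of the same block. *)
    case/orP: o => [ao|bo]; [left; exists a.-1|right; exists b.-1]; try by lia.
      have -> : a.-1 = (a./2).*2 by lia.
      have -> : b = (b./2).*2 by lia.
      by rewrite dilate_even.
    have -> : b.-1 = (b./2).*2 by lia.
    have -> : a = (a./2).*2 by lia.
    by rewrite dilate_even.
  rewrite negb_or => /andP[ae be].
  have [|[a' aa' ta']|[b' bb' tb']] := cnat_parent ct t1; first by lia.
    left; exists a'.*2; first by lia.
    have -> : b = (b./2).*2 by lia.
    by rewrite dilate_even.
  right; exists b'.*2; first by lia.
  have -> : a = (a./2).*2 by lia.
  by rewrite dilate_even.
- move=> a b a' b' tab aa' ta' bb' tb'.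
  have t1 := dilate_base tab; have t2 := dilate_base ta'.
  have t3 := dilate_base tb'.
  have [l1|l1] := ltnP a'./2 a./2.
    have [l2|l2] := ltnP b'./2 b./2; first exact: (cnat_parent1 ct t1 l1 t2 l2 t3).
    (* Here [b'] and [b] lie in the same block column, so [(a', b)] comes from a leaf of [t], which
       cannot have a dot below it. *)
    have bo : odd b by lia.
    have [|_ /(leaf_atP _ _ ct)[_ amax _]] := dilate_leaf ta'; first by lia.
    by have := amax _ t1; lia.
  have [|_ /(leaf_atP _ _ ct)[_ _ bmax]] := dilate_leaf tb'; first by lia.
  have [] := dilate_leaf tab; first by lia.
  move=> ab _; have := bmax _ t1; lia.
- by move=> a b a'; apply: dilate_below.
- move=> a b b'; rewrite -!(dilate_tr t) => tab bb' tab'.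
  have [a' aa' ta'] := dilate_below ct' tab bb' tab'.
  by exists a'; rewrite // -dilate_tr.
Qed.

(** The leaf of row [a./2] becomes a block whose first column meets both rows. *)
Lemma dilate_paired t : cnat_fun p t -> paired p.*2 (dilate p t).
Proof.
move=> ct a; rewrite oddD odd_double addbF => ae ap.
have [|b lb] := row_leaf (a := a./2) ct; first by lia.
exists b.*2; have -> : a = (a./2).*2 by lia.
by rewrite dilate_even dilate_odd_row lb andbT; case/andP: lb.
Qed.

Lemma dilate_paired_tr t :
  cnat_fun p t -> paired p.*2 (fun a b => dilate p t b a).
Proof.
move=> /cnat_fun_tr/dilate_paired pt a h1 h2.
by have [b] := pt a h1 h2; rewrite !(dilate_tr t); exists b.
Qed.

End Dilate.

(** * Contraction, the inverse of dilation on paired CNATs *)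

Section Contract.
Variables (p : nat).
Implicit Type t : nat -> nat -> bool.

Definition contract t a b : bool := t a.*2 b.*2.

(** By [leaf_block], a row with two dots has an even index. *)
Lemma paired_odd_single t a b b' : cnat_fun p.*2 t -> paired p.*2 t ->
  paired p.*2 (fun a b => t b a) -> odd a -> t a b -> t a b' -> b = b'.
Proof.
move=> ct pt pt'; wlog : b b' / (b < b')%N => [hw ao tb tb'|bb' ao tb tb'].
  by case: (ltngtP b b') => // ?; [apply: hw | apply/esym/hw].
have [l [bl tl lmax]] := row_end ct tb'.
have [[_ ae _ _] _] := leaf_block ct pt pt' tl (leq_trans bb' bl) tb lmax.
by move: ae; rewrite oddD odd_double addbF ao.
Qed.

(** The column shared by the two rows can only be that of the single dot of the odd row. Having two
    dots, this column is not odd. *)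
Lemma paired_odd_above t a b : cnat_fun p.*2 t -> paired p.*2 t ->
  paired p.*2 (fun a b => t b a) -> t a.*2.+1 b -> t a.*2 b /\ ~~ odd b.
Proof.
move=> ct pt pt' tb; have [_ _] := cnat_bound ct tb.
have [||c /andP[t1 t2]] := pt a.*2; first by lia.
  by have [] := cnat_bound ct tb.
have bc : b = c by apply: (paired_odd_single ct pt pt' _ tb t2) => /=; lia.
subst c; split=> //; apply/negP => bo.
have := paired_odd_single (cnat_fun_tr ct) pt' pt bo t1 t2; lia.
Qed.

(** The dot that row [a.*2] shares with the next row has a dot below, hence one to its right, so
    [leaf_block] applies to the end of the row. *)
Lemma paired_even_end t a : cnat_fun p.*2 t -> paired p.*2 t ->
  paired p.*2 (fun a b => t b a) -> (a < p)%N ->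
  exists b, [/\ t a.*2 b.*2, t a.*2.+1 b.*2, t a.*2 b.*2.+1 &
    forall b', t a.*2 b' -> (b' <= b.*2.+1)%N].
Proof.
move=> ct pt pt' ap; have [||c /andP[t1 t2]] := pt a.*2; [by lia | by lia |].
have [d cd td] := cnat_below ct t1 (ltnSn _) t2.
have [l [dl tl lmax]] := row_end ct td.
have cl : (c < l)%N by lia.
have [[lo _ tl1 tl2] _] := leaf_block ct pt pt' tl cl t1 lmax.
exists l./2; have <- : l.-1 = (l./2).*2 by lia.
by have -> : l.-1.+1 = l by lia.
Qed.

Lemma contract_below t a b a' : cnat_fun p.*2 t -> paired p.*2 t ->
  paired p.*2 (fun a b => t b a) -> contract t a b -> (a < a')%N ->
  contract t a' b -> exists2 b', (b < b')%N & contract t a b'.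
Proof.
rewrite /contract => ct pt pt' tab aa' ta'b.
have [a2 _] := cnat_bound ct tab.
have [|e [te1 te2 te3 emax]] := paired_even_end (a := a) ct pt pt'; first by lia.
have [|d bd td] := cnat_below ct tab _ ta'b; first by lia.
have be : (b <= e)%N by have := emax _ td; lia.
exists e => //; rewrite ltn_neqAle be andbT; apply/eqP=> eb; subst e.
(* If the leaf block were at [(a, b)] itself, its lower dot would have a dot below, hence a second
   dot in an odd row. *)
have [|d' bd' td'] := cnat_below ct te2 _ ta'b; first by lia.
have := paired_odd_single ct pt pt' _ te2 td'; rewrite /= odd_double; lia.
Qed.

Lemma contract_cnat t : cnat_fun p.*2 t -> paired p.*2 t ->
  paired p.*2 (fun a b => t b a) -> cnat_fun p (contract t).
Proof.
move=> ct pt pt'; have ct' := cnat_fun_tr ct; split.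
- by move=> a b /(cnat_bound ct); lia.
- exact: cnat_root ct.
- by move=> a ap; have [b [? _ _ _]] := paired_even_end ct pt pt' ap; exists b.
- by move=> b bp; have [a [? _ _ _]] := paired_even_end ct' pt' pt bp; exists a.
- move=> a b tab ab0; have [|[a' aa' ta']|[b' bb' tb']] := cnat_parent ct tab.
  + by lia.
  + left; exists a'./2; rewrite /contract; first by lia.
    (* A parent in an odd row is replaced by the dot just above it, which survives contraction. *)
    have [ao|ae] := boolP (odd a'); last by have -> : a'./2.*2 = a' by lia.
    have e : a' = (a'./2).*2.+1 by lia.
    by rewrite e in ta'; have [] := paired_odd_above ct pt pt' ta'.
  + right; exists b'./2; rewrite /contract; first by lia.
    have [ao|ae] := boolP (odd b'); last by have -> : b'./2.*2 = b' by lia.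
    have e : b' = (b'./2).*2.+1 by lia.
    by rewrite e in tb'; have [] := paired_odd_above ct' pt' pt tb'.
- move=> a b a' b' tab aa' ta' bb' tb'.
  by apply: (cnat_parent1 ct tab _ ta' _ tb'); lia.
- by move=> a b a'; apply: contract_below.
- by move=> a b b'; apply: (@contract_below _ b a b' ct' pt' pt).
Qed.

(** The last dot of a contracted row is the corner of a leaf block. Conversely, a dot in an odd row
    is alone there, so nothing lies below it, nor, by completeness, to the right of its corner in
    the contraction. *)
Lemma leaf_at_contract t a b : cnat_fun p.*2 t -> paired p.*2 t ->
  paired p.*2 (fun a b => t b a) -> leaf_at p (contract t) a b = t a.*2.+1 b.*2.
Proof.
move=> ct pt pt'; have cc := contract_cnat ct pt pt'.
apply/(leaf_atP _ _ cc)/idP => [[tab amax bmax]|tab].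
  have [a2 _] := cnat_bound ct tab.
  have [|e [te1 te2 te3 emax]] := paired_even_end (a := a) ct pt pt'; first by lia.
  have -> : b = e by have := emax _ tab; have := bmax _ te1; lia.
  exact: te2.
have [ta _] := paired_odd_above ct pt pt' tab.
have amax a' : contract t a' b -> (a' <= a)%N.
  move=> ta'; case: leqP => // aa'.
  have [|d' bd' td'] := cnat_below ct tab _ ta'; first by lia.
  by have := paired_odd_single ct pt pt' _ tab td'; rewrite /= odd_double; lia.
split=> // b' tb'; case: leqP => // bb'.
by have [a' aa' /amax] := cnat_right cc ta bb' tb'; rewrite leqNgt aa'.
Qed.

Lemma contractK t a b : cnat_fun p.*2 t -> paired p.*2 t ->
  paired p.*2 (fun a b => t b a) -> dilate p (contract t) a b = t a b.
Proof.
move=> ct pt pt'; have ct' := cnat_fun_tr ct.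
rewrite -[a]odd_double_half -[b]odd_double_half.
case: (boolP (odd a)) => _; case: (boolP (odd b)) => _; rewrite ?add1n ?add0n.
- rewrite dilate_odd; apply/esym/negP => tab.
  by have [_] := paired_odd_above ct pt pt' tab; rewrite /= odd_double.
- by rewrite dilate_odd_row leaf_at_contract.
- rewrite dilate_odd_col -(@leaf_at_contract _ _ _ ct' pt' pt).
  exact/esym/leaf_at_tr.
- by rewrite dilate_even.
Qed.

End Contract.

(** * From boolean matrices to relations on nat *)

Section Cell.
Variable n : nat.
Implicit Type T : 'M[bool]_n.

Definition cell T (a b : nat) : bool :=
  [exists i : 'I_n, exists j : 'I_n, [&& i == a :> nat, j == b :> nat & T i j]].

(** Case analysis on it replaces natural indices by ordinals throughout the goal. *)
Variant cell_spec T : nat -> nat -> Prop :=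
  CellSpec (i j : 'I_n) of T i j : cell_spec T i j.

Lemma cellP T a b : cell T a b -> cell_spec T a b.
Proof. by case/existsP=> i /existsP[j /and3P[/eqP<- /eqP<- Tij]]. Qed.

Lemma cellE T (i j : 'I_n) : cell T i j = T i j.
Proof.
apply/existsP/idP => [[i' /existsP[j' /and3P[]]]|Tij].
  by move=> /eqP/val_inj-> /eqP/val_inj->.
by exists i; apply/existsP; exists j; rewrite Tij !eqxx.
Qed.

Lemma cell_bound T a b : cell T a b -> (a < n)%N /\ (b < n)%N.
Proof. by case/cellP. Qed.

Lemma cell_tr T a b : cell T^T a b = cell T b a.
Proof.
by apply/idP/idP => /cellP[i j]; rewrite cellE mxE.
Qed.

Lemma cell_mx (t : nat -> nat -> bool) a b :
  (forall a b, t a b -> (a < n)%N /\ (b < n)%N) ->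
  cell (\matrix_(i, j) t i j) a b = t a b.
Proof.
move=> tB; apply/idP/idP => [/cellP[i j]|tab]; first by rewrite mxE.
have [an bn] := tB _ _ tab.
by rewrite -[a]/(val (Ordinal an)) -[b]/(val (Ordinal bn)) cellE mxE.
Qed.

Lemma dot_aboveP T (i j : 'I_n) :
  reflect (exists2 a, (a < i)%N & cell T a j) (dot_above T i j).
Proof.
apply: (iffP existsP) => [[a /andP[ai Taj]]|[a ai /existsP[i' /existsP[j']]]].
  by exists a; rewrite ?cellE.
case/and3P=> /eqP ea /eqP/val_inj-> Tij.
by exists i'; rewrite ea ai.
Qed.

Lemma dot_belowP T (i j : 'I_n) :
  reflect (exists2 a, (i < a)%N & cell T a j) (dot_below T i j).
Proof.
apply: (iffP existsP) => [[a /andP[ai Taj]]|[a ai /existsP[i' /existsP[j']]]].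
  by exists a; rewrite ?cellE.
case/and3P=> /eqP ea /eqP/val_inj-> Tij.
by exists i'; rewrite ea ai.
Qed.

Lemma dot_leftP T (i j : 'I_n) :
  reflect (exists2 b, (b < j)%N & cell T i b) (dot_left T i j).
Proof.
rewrite -dot_above_tr; apply: (iffP (dot_aboveP _ _ _)) => -[b bj];
by move=> h; exists b => //; move: h; rewrite cell_tr.
Qed.

Lemma dot_rightP T (i j : 'I_n) :
  reflect (exists2 b, (j < b)%N & cell T i b) (dot_right T i j).
Proof.
rewrite -dot_below_tr; apply: (iffP (dot_belowP _ _ _)) => -[b bj];
by move=> h; exists b => //; move: h; rewrite cell_tr.
Qed.

Lemma root_cellE (i j : 'I_n) : root_cell i j = (i + j == 0)%N.
Proof. by rewrite addn_eq0. Qed.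

Lemma is_cnatP T : reflect (cnat_fun n (cell T)) (is_cnat T).
Proof.
apply: (iffP idP) => [/andP[/and4P[root par rows cols] compl]|ct].
  (* Being internal or a leaf means that these two booleans agree. *)
  have full (i j : 'I_n) : T i j -> dot_below T i j = dot_right T i j.
    move=> Tij; have /implyP/(_ Tij) := forallP (forallP compl i) j.
    rewrite /is_internal /is_leaf Tij /=.
    by case: (dot_below T i j); case: (dot_right T i j).
  split.
  - by move=> a b /cell_bound.
  - have /existsP[i /existsP[j /andP[/andP[/eqP i0 /eqP j0]]]] := root.
    by rewrite -cellE i0 j0.
  - move=> a an; have /existsP[j] := forallP rows (Ordinal an).
    by exists j; rewrite -[a]/(val (Ordinal an)) cellE.
  - move=> b bn; have /existsP[i] := forallP cols (Ordinal bn).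
    by exists i; rewrite -[b]/(val (Ordinal bn)) cellE.
  - move=> _ _ /cellP[i j Tij] ij0.
    have /implyP := forallP (forallP par i) j; rewrite Tij root_cellE -lt0n ij0.
    move=> /(_ isT); have [/dot_aboveP|_] := boolP (dot_above T i j); first by left.
    by move/dot_leftP; right.
  - move=> _ _ a' b' /cellP[i j Tij] a'i ta'j b'j tib'.
    have /implyP := forallP (forallP par i) j; rewrite Tij root_cellE.
    have -> : dot_above T i j by apply/dot_aboveP; exists a'.
    have -> : dot_left T i j by apply/dot_leftP; exists b'.
    by case: eqP => [|_ /(_ isT)//]; lia.
  - move=> _ _ a' /cellP[i j Tij] ia' ta'j; apply/dot_rightP.
    by rewrite -full //; apply/dot_belowP; exists a'.
  - move=> _ _ b' /cellP[i j Tij] jb' tib'; apply/dot_belowP.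
    by rewrite full //; apply/dot_rightP; exists b'.
have [tB t0 tR tC tP tP1 tb tr] := ct.
have full (i j : 'I_n) : T i j -> dot_below T i j = dot_right T i j.
  rewrite -cellE => Tij; apply/dot_belowP/dot_rightP => -[c c1 c2].
    exact: (tb _ _ _ Tij c1 c2).
  exact: (tr _ _ _ Tij c1 c2).
apply/andP; split; last first.
  apply/forallP=> i; apply/forallP=> j; apply/implyP=> Tij.
  by rewrite /is_internal /is_leaf Tij full //=; case: dot_right.
apply/and4P; split.
- have [n0 _] := tB _ _ t0; pose o := Ordinal n0.
  by apply/existsP; exists o; apply/existsP; exists o; rewrite -cellE t0.
- apply/forallP=> i; apply/forallP=> j; apply/implyP=> /andP[Tij].
  rewrite root_cellE -lt0n => ij0; rewrite -cellE in Tij.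
  have [/dot_aboveP[a ai ta]|na] := boolP (dot_above T i j).
    apply/negP => /dot_leftP[b bj tb']; exact: (tP1 _ _ _ _ Tij ai ta bj tb').
  have [/dot_aboveP|/dot_leftP//] := tP _ _ Tij ij0.
  by rewrite (negPf na).
- apply/forallP=> i; have [b /[dup] tib /tB[_ bn]] := tR i (ltn_ord i).
  by apply/existsP; exists (Ordinal bn); rewrite -cellE.
- apply/forallP=> j; have [a /[dup] taj /tB[an _]] := tC j (ltn_ord j).
  by apply/existsP; exists (Ordinal an); rewrite -cellE.
Qed.

End Cell.

(** * Exchange of adjacent rows and cancellation *)

Lemma eq_cnat_fun n t t' : (forall a b, t a b = t' a b) ->
  cnat_fun n t -> cnat_fun n t'.
Proof.
move=> e [tB t0 tR tC tP tP1 tb tr]; split.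
- by move=> a b; rewrite -e; apply: tB.
- by rewrite -e.
- by move=> a /tR[b]; exists b; rewrite -e.
- by move=> b /tC[a]; exists a; rewrite -e.
- move=> a b; rewrite -e => tab /(tP _ _ tab)[[a' ? ?]|[b' ? ?]].
    by left; exists a'; rewrite -?e.
  by right; exists b'; rewrite -?e.
- by move=> a b a' b'; rewrite -!e; apply: tP1.
- by move=> a b a'; rewrite -!e => h1 h2 /(tb _ _ _ h1 h2)[b']; exists b'; rewrite -?e.
- by move=> a b b'; rewrite -!e => h1 h2 /(tr _ _ _ h1 h2)[a']; exists a'; rewrite -?e.
Qed.

(** The CNAT conditions only compare dots of the same row or of the same column, and [s] keeps the
    order of the dots within each column. *)
Lemma cnat_fun_reorder n t (s : nat -> nat) : cnat_fun n t ->
  involutive s -> s 0%N = 0%N -> (forall a, (a < n)%N -> (s a < n)%N) ->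
  (forall a a' b, t (s a) b -> t (s a') b -> (a < a')%N -> (s a < s a')%N) ->
  cnat_fun n (fun a => t (s a)).
Proof.
move=> [tB t0 tR tC tP tP1 tb tr] sK s0 sB sO.
have sO' a a' b : t a b -> t a' b -> (a < a')%N -> (s a < s a')%N.
  move=> ta ta' aa'; case: (ltngtP (s a) (s a')) => //.
    by move=> /(sO _ _ b); rewrite !sK => /(_ ta' ta); lia.
  by move/(can_inj sK) => e; rewrite e ltnn in aa'.
split.
- by move=> a b /tB[/sB]; rewrite sK.
- by rewrite s0.
- by move=> a /sB/tR.
- by move=> b /tC[a ta]; exists (s a); rewrite sK.
- move=> a b tab ab0; have [|[a' aa' ta']|?] := tP _ _ tab; last by right.
    have [sa0|sa0] := posnP (s a); last by lia.
    by have a0 : a = 0%N; [rewrite -(sK a) sa0 | move: ab0; rewrite sa0 a0].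
  by left; exists (s a'); rewrite ?sK //; move: (sO' _ _ _ ta' tab aa'); rewrite sK.
- move=> a b a' b' tab aa' ta' bb' tb'.
  exact: (tP1 _ _ _ _ tab (sO _ _ _ ta' tab aa') ta' bb' tb').
- by move=> a b a' tab aa' ta'; apply: (tb _ _ _ tab (sO _ _ _ tab ta' aa')).
- move=> a b b' tab bb' tab'; have [a' aa' ta'] := tr _ _ _ tab bb' tab'.
  by exists (s a'); rewrite ?sK //; move: (sO' _ _ _ tab ta' aa'); rewrite sK.
Qed.

Section Swap.
Variable n : nat.
Implicit Type T : 'M[bool]_n.

Definition adjacent (i i' : 'I_n) := (0 < i)%N && (i' == i.+1 :> nat).

Definition swap_nat a x := if x == a then a.+1 else if x == a.+1 then a else x.

Lemma swap_natK a : involutive (swap_nat a).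
Proof. by move=> x; rewrite /swap_nat; do !case: ifP => //; lia. Qed.

Lemma cell_xrow T (i i' : 'I_n) a b : adjacent i i' ->
  cell (xrow i i' T) a b = cell T (swap_nat i a) b.
Proof.
case/andP=> i0 /eqP ei'.
have h (U : 'M[bool]_n) (k j : 'I_n) :
    cell (xrow i i' U) k j = cell U (swap_nat i k) j.
  rewrite cellE mxE /swap_nat; case: tpermP => [->|->|ki ki'].
  - by rewrite eqxx -ei' cellE.
  - by rewrite ei' eqn_leq ltnn eqxx cellE.
  - rewrite -ei'; case: eqP => [/val_inj//|_].
    by case: eqP => [/val_inj//|_]; rewrite cellE.
apply/idP/idP => [/cellP[k j]|]; first by rewrite -cellE h.
move=> /[dup] /cell_bound[san bn]; have an : (a < n)%N.
  by have := ltn_ord i'; move: san; rewrite /swap_nat; do !case: ifP; lia.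
by rewrite -[a]/(val (Ordinal an)) -[b]/(val (Ordinal bn)) h.
Qed.

Definition shared T a := [exists j : 'I_n, cell T a j && cell T a.+1 j].

Lemma sharedP T a :
  reflect (exists b, cell T a b && cell T a.+1 b) (shared T a).
Proof.
apply: (iffP existsP) => [[j]|[b /andP[/existsP[i /existsP[j]]]]].
  by exists j.
case/and3P=> /eqP ei /eqP ej Tij tb; exists j.
by rewrite -{1}ei cellE Tij ej.
Qed.

(** Only two rows change their relative order, and no column has dots in both. *)
Lemma cnat_xrow T (i i' : 'I_n) : adjacent i i' -> is_cnat T ->
  ~~ shared T i -> is_cnat (xrow i i' T).
Proof.
move=> adj /is_cnatP ct ns; apply/is_cnatP.
apply: (@eq_cnat_fun _ (fun a => cell T (swap_nat i a))).
  by move=> a b; rewrite cell_xrow.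
have [i0 /eqP ei'] := andP adj; have i1n := ltn_ord i'.
apply: cnat_fun_reorder => //; first exact: swap_natK.
- by rewrite /swap_nat; do !case: ifP; lia.
- by move=> a an; rewrite /swap_nat; do !case: ifP; lia.
move=> a a' b ta ta' aa'.
have [e|] := eqVneq a i; last by move: aa'; rewrite /swap_nat; do !case: ifP; lia.
have [e'|] := eqVneq a' i.+1.
  case/negP: ns; apply/sharedP; exists b; move: ta ta'; rewrite e e' /swap_nat.
  by rewrite eqxx ifF ?eqxx => [-> ->|]; last by lia.
by move: aa'; rewrite /swap_nat; do !case: ifP; lia.
Qed.

Lemma det_xrow T (i i' : 'I_n) : adjacent i i' ->
  \det (nat_matrix (xrow i i' T)) = - \det (nat_matrix T).
Proof.
case/andP=> _ /eqP ei'; rewrite /nat_matrix map_xrow xrowE det_mulmx det_perm.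
rewrite odd_tperm; have -> : i != i' by rewrite -val_eqE /= ei' neq_ltn ltnSn.
by rewrite expr1 mulN1r.
Qed.

Lemma xrowK T (i i' : 'I_n) : xrow i i' (xrow i i' T) = T.
Proof. by apply/matrixP=> k j; rewrite !mxE tpermK. Qed.

(** Pairs starting at indices of the same parity are equal or disjoint. *)
Lemma shared_xrow T (i i' : 'I_n) a : adjacent i i' -> ~~ odd (a + i) ->
  shared (xrow i i' T) a = shared T a.
Proof.
move=> adj ai; apply: eq_existsb => j; rewrite !cell_xrow // /swap_nat.
have [->|ne] := eqVneq a i.
  by rewrite eqxx ifF ?eqxx 1?andbC //; lia.
by rewrite !ifF //; lia.
Qed.

Lemma shared_xcol T (j j' : 'I_n) a : shared (xcol j j' T) a = shared T a.
Proof.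
have h U : shared U a -> shared (xcol j j' U) a.
  case/existsP=> k /andP[/existsP[i /existsP[k1]] /[swap] /existsP[i' /existsP[k2]]].
  move=> /and3P[/eqP ei' /eqP/val_inj-> T2] /and3P[/eqP ei /eqP/val_inj-> T1].
  apply/existsP; exists (tperm j j' k).
  by rewrite -ei' -{1}ei !cellE !mxE tpermK T1 T2.
have xK : xcol j j' (xcol j j' T) = T.
  by apply/matrixP=> k l; rewrite !mxE tpermK.
by apply/idP/idP => /h //; rewrite xK.
Qed.

(* Row 0 is left alone, so that the root is never moved. *)
Definition shared_below T k := all
  (fun a => [&& (0 < a)%N, ~~ odd (a + n) & (a.+1 < n)%N] ==> shared T a) (iota 0 k).

Definition rows_shared T := shared_below T n.

Lemma rows_shared_xcol T (j j' : 'I_n) :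
  rows_shared (xcol j j' T) = rows_shared T.
Proof. by apply: eq_all => a; rewrite shared_xcol. Qed.

(** Reindexing by [g] shows that the part of the sum outside [Q] is its own opposite. *)
Lemma sum_sign_reversing (I : finType) (P Q : pred I) (f : I -> int) (g : I -> I) :
  involutive g -> (forall x, P x -> ~~ Q x -> P (g x) /\ ~~ Q (g x)) ->
  (forall x, f (g x) = - f x) ->
  \sum_(x | P x) f x = \sum_(x | P x && Q x) f x.
Proof.
move=> gK PQ fg; rewrite (bigID Q) /= -[RHS]addr0; congr (_ + _).
set S := \sum_(x | _) _; have: S = - S.
  rewrite {1}/S (reindex_inj (inv_inj gK)) /= -sumrN.
  apply: eq_big => [x|x _]; last exact: fg.
  apply/andP/andP => -[Px Qx]; first by have := PQ _ Px Qx; rewrite gK.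
  exact: PQ.
by move/eqP; rewrite -addr_eq0 -mulr2n mulrn_eq0 /= => /eqP.
Qed.

(** Pairs of rows are treated one at a time: the exchange cancels the CNATs in which the current
    pair shares no column and leaves the earlier pairs shared. [P] allows a condition on columns to
    be carried along. *)
Lemma sum_rows_shared (P : pred 'M[bool]_n) :
  (forall T i i', P T -> P (xrow i i' T)) ->
  \sum_(T | is_cnat T && P T) \det (nat_matrix T) =
  \sum_(T | [&& is_cnat T, P T & rows_shared T]) \det (nat_matrix T).
Proof.
move=> Pcl; suff h k : \sum_(T | is_cnat T && P T) \det (nat_matrix T) =
    \sum_(T | [&& is_cnat T, P T & shared_below T k]) \det (nat_matrix T).
  exact: h.
elim: k => [|k ->]; first by apply: eq_bigl => T; rewrite andbT.
have shS T : shared_below T k.+1 = shared_below T k &&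
    ([&& (0 < k)%N, ~~ odd (k + n) & (k.+1 < n)%N] ==> shared T k).
  by rewrite /shared_below -[in iota _ _](addn1 k) iotaD all_cat /= andbT.
have [/and3P[k0 ko k1]|/negPf kF] :=
    boolP [&& (0 < k)%N, ~~ odd (k + n) & (k.+1 < n)%N]; last first.
  by apply: eq_bigl => T; rewrite shS kF andbT.
pose i := Ordinal (ltnW k1); pose i' := Ordinal k1.
have adj : adjacent i i' by rewrite /adjacent k0 /=.
have xT : involutive (@xrow bool n n i i') by move=> T; apply: xrowK.
rewrite (@sum_sign_reversing _ _ (shared^~ k) _ _ xT).
- by apply: eq_bigl => T; rewrite shS k0 ko k1 /= -!andbA.
- move=> T /and3P[cT PT sT] nT; rewrite shared_xrow //=; last by rewrite addnn odd_double.
  split=> //; rewrite cnat_xrow //= Pcl //=; apply/allP=> a ak.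
  apply/implyP=> /[dup] /and3P[a0 ao a1] h; rewrite shared_xrow //; last by rewrite /=; lia.
  by have /allP/(_ a ak)/implyP/(_ h) := sT.
- by move=> T; exact: det_xrow.
Qed.

Lemma is_cnat_trE T : is_cnat T^T = is_cnat T.
Proof. by apply/idP/idP => /is_cnat_tr //; rewrite trmxK. Qed.

(** The row reduction is done twice, with a transposition in between. Row exchanges of the second
    pass are column exchanges for the first condition, which they preserve. *)
Lemma sum_shared :
  \sum_(T : 'M[bool]_n | is_cnat T) \det (nat_matrix T) =
  \sum_(T : 'M[bool]_n | [&& is_cnat T, rows_shared T^T & rows_shared T])
    \det (nat_matrix T).
Proof.
transitivity (\sum_(T : 'M[bool]_n | is_cnat T && predT T) \det (nat_matrix T)).
  by apply: eq_bigl => T; rewrite andbT.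
rewrite sum_rows_shared //= (reindex_inj (@trmx_inj _ n n)) /=.
rewrite -sum_rows_shared => [|T i i'].
  apply: eq_big => [T|T _]; first by rewrite is_cnat_trE.
  by rewrite /nat_matrix -map_trmx det_tr.
by rewrite tr_xrow rows_shared_xcol.
Qed.

(** The pair of rows 0 and 1, left out of [rows_shared], always shares a column: the leftmost dot of
    row 1 has its parent in row 0. *)
Lemma rows_sharedP T : is_cnat T ->
  reflect (paired n (cell T)) (rows_shared T).
Proof.
move=> /is_cnatP ct; apply: (iffP allP) => [h a ao an|h a _].
  have [a0|a0] := posnP a; last first.
    apply/sharedP; have := h a; rewrite a0 ao an mem_iota; apply; lia.
  have [b t1b] := cnat_row ct an; rewrite a0 in t1b *.
  have exP : exists b, cell T 1%N b by exists b.
  case: (ex_minnP exP) => d t1d dmin; exists d; rewrite t1d andbT.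
  have [|[c c1 tc]|[d' d'd /dmin]] := cnat_parent ct t1d; first by lia.
    by have <- : c = 0%N by lia.
  by rewrite leqNgt d'd.
by apply/implyP=> /and3P[_ ao an]; apply/sharedP/h.
Qed.

End Swap.

(** * The determinant as the sign of the leaf permutation *)

Section LeafMatrix.
Variable n : nat.
Implicit Type T : 'M[bool]_n.

Definition leaf_matrix T : 'M[int]_n := \matrix_(i, j) (is_leaf T i j)%:R.

Lemma cnat_col_leaf T j : is_cnat T -> exists! i, is_leaf T i j.
Proof.
move=> /is_cnat_tr cT; have [i [Hi U]] := cnat_row_leaf j cT.
exists i; split=> [|i' Hi']; first by rewrite -is_leaf_tr.
by apply: U; rewrite is_leaf_tr.
Qed.

(* Below an internal dot in its column there is a leaf alone in its row, so a
   permutation supported by the dots cannot use the internal dot. *)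
Lemma perm_dots_leaves T (s : {perm 'I_n}) : is_cnat T ->
  (forall i, T i (s i)) -> forall i, is_leaf T i (s i).
Proof.
move=> cT dots i; have /andP[_ /forallP/(_ i)/forallP/(_ (s i))] := cT.
rewrite dots => /= /orP[/and3P[_ /dot_belowP[a ia ta] _]|//].
have /is_cnatP ct := cT.
have [l [al tl lmax]] := col_end ct ta.
have il := leq_trans ia al; have [ln _] := cnat_bound ct tl.
have ts : cell T i (s i) by rewrite cellE dots.
have tl' : cell T (Ordinal ln) (s (Ordinal ln)) by rewrite cellE dots.
have /val_inj/perm_inj e := col_end_single ct tl il ts lmax tl'.
by rewrite -e /= ltnn in il.
Qed.

(** The two Leibniz expansions agree term by term: a permutation using an undotted cell contributes
    zero to both, and any other uses only leaves. *)
Lemma det_leaf_matrix T : is_cnat T ->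
  \det (nat_matrix T) = \det (leaf_matrix T).
Proof.
move=> cT; apply: eq_bigr => s _; congr (_ * _).
have [/forallP dots|] := boolP [forall i, T i (s i)].
  apply: eq_bigr => i _; rewrite !mxE dots.
  by rewrite (perm_dots_leaves cT dots).
rewrite negb_forall => /existsP[i /negPf Ti].
by rewrite (bigD1 i) // [RHS](bigD1 i) //= !mxE /is_leaf Ti !mul0r.
Qed.

(** With one leaf in each row and column, the leaf matrix times its transpose is the identity. *)
Lemma det_leaf_matrix_sqr T : is_cnat T ->
  \det (leaf_matrix T) * \det (leaf_matrix T) = 1.
Proof.
move=> cT; rewrite -{2}det_tr -det_mulmx -[RHS](det1 _ n); congr (\det _).
apply/matrixP=> i k; rewrite !mxE.
have [j [lj Uj]] := cnat_row_leaf i cT; rewrite (bigD1 j) //= big1 => [|j' jj'].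
  rewrite !mxE lj mul1r addr0 [in RHS]eq_sym; congr ((_ : bool)%:R).
  have [i' [_ Ui]] := cnat_col_leaf j cT; apply/idP/eqP => [lk|->//].
  by rewrite -(Ui _ lj) -(Ui _ lk).
rewrite !mxE; case: (boolP (is_leaf T i j')) => [/Uj e|_]; last by rewrite mul0r.
by rewrite e eqxx in jj'.
Qed.

Lemma det_cnat T : is_cnat T ->
  \det (nat_matrix T) = 1 \/ \det (nat_matrix T) = -1.
Proof.
move=> cT; have := det_leaf_matrix_sqr cT; rewrite -det_leaf_matrix // -expr2.
by move/eqP; rewrite sqrf_eq1 => /orP[] /eqP; [left | right].
Qed.

Lemma cnat_setE : cnat_set n = [set T | is_cnat T].
Proof.
apply/setP=> T; rewrite !inE; case: (boolP (is_cnat T)) => //= cT.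
by rewrite cnat_size_rows ?eqxx.
Qed.

Lemma num_cnat_detE :
  (num_cnat n)%:R = (num_cnat_det n 1)%:R + (num_cnat_det n (-1))%:R :> int /\
  \sum_(T : 'M[bool]_n | is_cnat T) \det (nat_matrix T)
  = (num_cnat_det n 1)%:R - (num_cnat_det n (-1))%:R.
Proof.
have cE e : (num_cnat_det n e)%:R =
    \sum_(T : 'M[bool]_n | is_cnat T) (\det (nat_matrix T) == e)%:R :> int.
  rewrite /num_cnat_det -sum1_card natr_sum cnat_setE big_mkcond [RHS]big_mkcond /=.
  by apply: eq_bigr => T _; rewrite !inE; case: is_cnat; case: eqP.
rewrite !cE -big_split -sumrB /= /num_cnat -sum1_card natr_sum cnat_setE.
split; last by apply: eq_bigr => T /det_cnat[]->.
by apply: eq_big => [T|T]; rewrite inE // => /det_cnat[]->.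
Qed.

End LeafMatrix.

(** * The signed sum in even size *)

Section Double.
Variable p : nat.
Implicit Types (T : 'M[bool]_p) (U : 'M[bool]_(p.*2)).

Definition dilate_mx T : 'M[bool]_p.*2 := \matrix_(i, j) dilate p (cell T) i j.
Definition contract_mx U : 'M[bool]_p := \matrix_(i, j) contract (cell U) i j.

Lemma cell_dilate_mx T a b : is_cnat T ->
  cell (dilate_mx T) a b = dilate p (cell T) a b.
Proof.
by move=> /is_cnatP ct; apply: cell_mx => c d /(cnat_bound (dilate_cnat ct)).
Qed.

Lemma cell_contract_mx U a b : cell (contract_mx U) a b = contract (cell U) a b.
Proof. by apply: cell_mx => c d /cell_bound; lia. Qed.

Lemma eq_paired n t t' : (forall a b, t a b = t' a b) -> paired n t -> paired n t'.
Proof. by move=> e pt a h1 h2; have [b] := pt a h1 h2; exists b; rewrite -!e. Qed.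

Lemma eq_dilate t t' a b : (forall a b, t a b = t' a b) ->
  dilate p t a b = dilate p t' a b.
Proof.
move=> e; rewrite /dilate /leaf_at !e.
by under eq_all => c do rewrite !e.
Qed.

Lemma cnat_dilate T : is_cnat T -> is_cnat (dilate_mx T).
Proof.
move=> cT; apply/is_cnatP/(eq_cnat_fun _ (dilate_cnat (is_cnatP _ cT))) => a b.
by rewrite cell_dilate_mx.
Qed.

Definition all_shared n (V : 'M[bool]_n) :=
  [&& is_cnat V, rows_shared V^T & rows_shared V].

Lemma all_sharedP n (V : 'M[bool]_n) : reflect
  [/\ cnat_fun n (cell V), paired n (cell V) & paired n (fun a b => cell V b a)]
  (all_shared V).
Proof.
apply: (iffP and3P) => [[cV rc rr]|[/is_cnatP cV rr rc]]; split=> //.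
- exact/is_cnatP.
- exact/(rows_sharedP cV).
- have := rc; rewrite -is_cnat_trE in cV; move/(rows_sharedP cV).
  by apply: eq_paired => a b; rewrite cell_tr.
- rewrite -is_cnat_trE in cV; apply/(rows_sharedP cV).
  by move: rc; apply: eq_paired => a b; rewrite cell_tr.
- exact/(rows_sharedP cV).
Qed.

Lemma all_shared_dilate : [set U | all_shared U] = dilate_mx @: [set T | is_cnat T].
Proof.
apply/setP=> U; rewrite inE; apply/all_sharedP/imsetP => [[ct pt pt']|[T]].
  have cC : is_cnat (contract_mx U).
    apply/is_cnatP/(eq_cnat_fun _ (contract_cnat ct pt pt')) => a b.
    by rewrite cell_contract_mx.
  exists (contract_mx U); rewrite ?inE //; apply/matrixP=> i j; rewrite mxE.
  rewrite (eq_dilate (t' := contract (cell U))) ?contractK ?cellE // => a b.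
  exact: cell_contract_mx.
rewrite inE => cT ->; have /is_cnatP ct := cT; split.
- exact/is_cnatP/cnat_dilate.
- by apply: eq_paired (dilate_paired ct) => a b; rewrite cell_dilate_mx.
- by apply: eq_paired (dilate_paired_tr ct) => a b; rewrite cell_dilate_mx.
Qed.

Lemma dilate_mx_inj : {in [set T | is_cnat T] &, injective dilate_mx}.
Proof.
move=> T T'; rewrite !inE => cT cT' e; apply/matrixP=> i j.
rewrite -!cellE -(dilate_even p) -[RHS](dilate_even p).
by rewrite -!cell_dilate_mx // e.
Qed.

(** Rows and columns undergo the same permutation, so its sign is squared. The equation [m = n] is a
    hypothesis because [p + p] and [p.*2] are not convertible. *)
Lemma det_mxsub_inj m n (A : 'M[int]_n) (f : 'I_m -> 'I_n) :
  m = n -> injective f ->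
  \det (mxsub f f A) = \det A.
Proof.
move=> e; subst m => f_inj; pose s := perm f_inj.
have -> : mxsub f f A = perm_mx s *m A *m (perm_mx s)^T.
  by rewrite tr_perm_mx -row_permE -col_permE; apply/matrixP=> i j; rewrite !mxE !permE.
by rewrite !det_mulmx det_tr det_perm mulrAC -signr_addb addbb mul1r.
Qed.

Lemma det_block_antitriangular (A L : 'M[int]_p) :
  \det (block_mx A L L 0) = (-1) ^+ p * (\det L * \det L).
Proof.
(* Right multiplication by [J] gives the block triangular matrix [-L A; 0 L]. [J] itself is a
   product of three unitriangular block matrices. *)
pose J : 'M[int]_(p + p) := block_mx 0 1%:M (- 1%:M) 0.
have detJ : \det J = 1.
  have -> : J = block_mx 1%:M 0 (- 1%:M) 1%:M *m block_mx 1%:M 1%:M 0 1%:M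
      *m block_mx 1%:M 0 (- 1%:M) 1%:M.
    rewrite !mulmx_block !(mulmx0, mul0mx, mulmx1, mul1mx, mulmxN, mulNmx).
    by rewrite !(addr0, add0r, addNr, subrr, oppr0).
  by rewrite !det_mulmx !det_lblock det_ublock !det1 !mulr1.
rewrite -[LHS]mulr1 -detJ -det_mulmx mulmx_block.
rewrite !(mulmx0, mul0mx, mulmx1, mul1mx, mulmxN, mulNmx) !(addr0, add0r).
by rewrite detJ det_ublock -scaleN1r detZ mulrA.
Qed.

Definition interleave_nat (k : 'I_(p + p)) : nat :=
  match split k with inl i => i.*2 | inr i => i.*2.+1 end.

Lemma interleave_nat_lt k : (interleave_nat k < p.*2)%N.
Proof.
by rewrite /interleave_nat; case: split => i; have := ltn_ord i; lia.
Qed.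

Definition interleave k : 'I_p.*2 := Ordinal (interleave_nat_lt k).

Lemma interleave_inj : injective interleave.
Proof.
move=> k k' [e]; apply: (can_inj (@splitK p p)); move: e; rewrite /interleave_nat.
by case: split => i; case: split => i' e; try lia; congr (_ _); apply/val_inj => /=; lia.
Qed.

Lemma leaf_at_cell T (i j : 'I_p) : is_cnat T ->
  leaf_at p (cell T) i j = is_leaf T i j.
Proof.
move=> /is_cnatP ct; apply/(leaf_atP _ _ ct)/and3P => [[tij imax jmax]|].
  split; first by rewrite -cellE.
    by apply/dot_belowP => -[a ia /imax]; rewrite leqNgt ia.
  by apply/dot_rightP => -[b jb /jmax]; rewrite leqNgt jb.
rewrite -cellE => -[tij nb nr]; split=> // c tc; rewrite leqNgt; apply/negP => lc.
  by case/dot_belowP: nb; exists c.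
by case/dot_rightP: nr; exists c.
Qed.

(* Listing even indices before odd ones turns the matrix of [dilate_mx T] into
   [M L; L 0], with M the matrix of T and L its leaf matrix. *)
Lemma det_dilate T : is_cnat T -> \det (nat_matrix (dilate_mx T)) = (-1) ^+ p.
Proof.
move=> cT; rewrite -(det_mxsub_inj _ (addnn p) interleave_inj).
have -> : mxsub interleave interleave (nat_matrix (dilate_mx T)) =
    block_mx (nat_matrix T) (leaf_matrix T) (leaf_matrix T) 0.
  apply/matrixP=> k k'; rewrite !mxE /= /interleave_nat.
  case: split => i; rewrite !mxE; case: split => j; rewrite ?mxE.
  - by rewrite dilate_even cellE.
  - by rewrite dilate_odd_col leaf_at_cell.
  - by rewrite dilate_odd_row leaf_at_cell.
  - by rewrite dilate_odd.
by rewrite det_block_antitriangular det_leaf_matrix_sqr ?mulr1.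
Qed.

Lemma sum_det_even : \sum_(U : 'M[bool]_p.*2 | is_cnat U) \det (nat_matrix U)
  = (-1) ^+ p * (num_cnat p)%:R.
Proof.
rewrite sum_shared (eq_bigl [in [set U | all_shared U]]) => [|U]; last by rewrite inE.
rewrite all_shared_dilate big_imset /=; last exact: dilate_mx_inj.
rewrite /num_cnat cnat_setE (eq_bigr (fun=> (-1) ^+ p)) => [|T]; last first.
  by rewrite inE; apply: det_dilate.
by rewrite sumr_const mulr_natr.
Qed.

End Double.

(** * Odd size, and the counts recovered from the signed sums *)

Lemma sum_det_odd n : (1 < n)%N -> odd n ->
  \sum_(T : 'M[bool]_n | is_cnat T) \det (nat_matrix T) = 0.
Proof.
move=> n1 no; rewrite sum_shared big1 // => T /all_sharedP[ct pt pt'].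
by have n_1 := paired_odd_size ct pt pt' no; rewrite n_1 in n1.
Qed.

(** Since every determinant is 1 or -1, the two counts have sum [num_cnat n] and difference [s]. *)
Lemma num_cnat_det_rat n (s : int) :
  \sum_(T : 'M[bool]_n | is_cnat T) \det (nat_matrix T) = s ->
  (num_cnat_det n 1)%:R = ((num_cnat n)%:R + s%:~R) / 2 :> rat /\
  (num_cnat_det n (-1))%:R = ((num_cnat n)%:R - s%:~R) / 2 :> rat.
Proof.
have [/(congr1 (intr : int -> rat)) tot ->] := num_cnat_detE n.
move=> /(congr1 (intr : int -> rat)); move: tot.
rewrite rmorphB rmorphD /= !rmorph_nat => -> <-.
by split; apply: (canRL (mulfK _)) => //; ring.
Qed.

Theorem theorem1 (n : nat) (hn : (1 <= n)%N) :
  ((1 < n)%N -> odd n ->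
     (num_cnat_det n 1)%:R = (num_cnat n)%:R / 2 :> rat /\
     (num_cnat_det n (-1))%:R = (num_cnat n)%:R / 2 :> rat) /\
  (forall p : nat, n = (2 * p)%N ->
     (num_cnat_det (2 * p) 1)%:R
       = ((num_cnat (2 * p))%:R + (-1) ^+ p * (num_cnat p)%:R) / 2 :> rat /\
     (num_cnat_det (2 * p) (-1))%:R
       = ((num_cnat (2 * p))%:R - (-1) ^+ p * (num_cnat p)%:R) / 2 :> rat).
Proof.
split=> [n1 no|p _].
  by have := num_cnat_det_rat (sum_det_odd n1 no); rewrite !mulr0z addr0.
rewrite mul2n; have := num_cnat_det_rat (sum_det_even p).
by rewrite rmorphM rmorphXn rmorphN rmorph1 rmorph_nat.
Qed.
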